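(* Let $H$ be a complete metric space of Busemann nonpositive curvature, let $n\ge 3$, and let $\sigma=\{x_1,\dots,x_n\}\in\Sigma_n(H)$ be such that $x_i\ne x_j$ for $i\neq j$. Let the sequences of points $(x_i^k)_{k=1}^\infty$, $i=1,\dots,n$, be obtained from $\sigma$ by the inductive construction described in the context. Then there exists a common limit point $\mathrm{mp}(\sigma)$ for all the sequences $(x_i^k)_{k=1}^\infty$, $i=1,\dots,n$.
   Context: A complete metric space $(H,d)$ is of Busemann nonpositive curvature if any two points are joined by a unique geodesic segment and, writing $m(x,y)$ for the midpoint of the geodesic segment joining $x$ and $y$, one has $d(m(x,y),m(x,z))\le \tfrac12 d(y,z)$ for all $x,y,z\in H$. $\Sigma_n(H)$ is the space of all $n$-nets $\{x_1,\dots,x_n\}$ of $H$. Inductive construction of the mean point: for $n=2$ put $\mathrm{mp}(\{x_1,x_2\})=m(x_1,x_2)$. Assume that the mapping $\mathrm{mp}:\Sigma_{n-1}(H)\to H$ has been correctly defined. For $\sigma=\{x_1,\dots,x_n\}$ with pairwise distinct points consider the set $\sigma^1=\{x_1^1,\dots,x_n^1\}$, where $x_i^1=\mathrm{mp}\{x_1,\dots,\widehat{x_i},\dots,x_n\}$ and $\widehat{x_i}$ means that this point is excluded from $\sigma$. Repeat the procedure with $\sigma^1$ to get $\sigma^2=\{x_1^2,\dots,x_n^2\}$, and so on; the $k$-th step gives $\sigma^k=\{x_1^k,\dots,x_n^k\}$. The common limit point, once shown to exist, is taken as the definition of $\mathrm{mp}(\sigma)$. *)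

(* Defs.v *)
From HB Require Import structures.
From mathcomp Require Import all_boot all_order all_algebra.
From mathcomp Require Import finmap.
From mathcomp Require Import boolp classical_sets set_interval reals topology.
From mathcomp Require Import metric_structure.

Set Implicit Arguments.
Unset Strict Implicit.
Unset Printing Implicit Defensive.

Import Order.TTheory GRing.Theory Num.Theory.

Local Open Scope classical_set_scope.
Local Open Scope ring_scope.

(* [Complete] is pointed, so these are the nonempty complete metric spaces. *)
#[short(type="completeMetricType")]
HB.structure Definition CompleteMetric (R : numDomainType) :=
  {M of Complete M & Metric R M}.

Section Busemann.
Context {R : realType} {H : completeMetricType R}.
Implicit Types (x y z : H) (A : set H) (S : {fset H}).

Local Notation d := (@mdist R H).

(* Only the values of [g] on [0, d x y] matter. *)
Definition is_geodesic x y (g : R -> H) : Prop :=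
  [/\ g 0 = x, g (d x y) = y &
      forall s t, 0 <= s <= d x y -> 0 <= t <= d x y ->
        d (g s) (g t) = `|s - t|].

Definition geodesic_segment x y A : Prop :=
  exists2 g : R -> H, is_geodesic x y g & A = g @` `[0, d x y].

(* In a uniquely geodesic space exactly one point satisfies this predicate. *)
Definition midpoint x y : H :=
  get [set z | exists A, [/\ geodesic_segment x y A, A z,
                             d x z = d x y / 2 & d z y = d x y / 2]].

Definition busemann_npc : Prop :=
  (forall x y, exists! A, geodesic_segment x y A) /\
  (forall x y z, d (midpoint x y) (midpoint x z) <= d y z / 2).

(* One step of the construction: [x_i |-> f {x_1, .., x_n} without x_i], where
   the index [i], not the value [x_i], is left out. *)
Definition mp_step (f : {fset H} -> H) {n} (x : 'I_n -> H) : 'I_n -> H :=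
  fun i => f [fset x j | j : 'I_n & j != i]%fset.

(* [mp n] is the mean point on n-nets, an n-net being a nonempty set of at most
   n points: every (n-1)-net is also an n-net, and a net with fewer than n points
   has the mean point it already got at the previous stage. So coincident points
   count once, and [{x, y}] with [x = y] is allowed for [n <= 2]. For an n-net
   with exactly n points, [mp n S] is the common limit of the sequences started
   from an enumeration [x] of [S]; reordering [x] only permutes the sequences. *)
Fixpoint mp (n : nat) (S : {fset H}) : H :=
  match n with
  | 0 | 1 | 2 =>
    get [set p | exists x y, S = [fset x; y]%fset /\ p = midpoint x y]
  | m.+1 =>
    if (#|` S|%fset <= m)%N then mp m S else
    get [set p | exists x : 'I_m.+1 -> H,
      [/\ injective x, S = [fset x i | i : 'I_m.+1]%fset &
          forall i, iter k (mp_step (mp m)) x i @[k --> \oo] --> p]]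
  end.

(* [mp_seq x k i] is the point x_i^k, with [x] itself as the 0-th term. *)
Definition mp_seq n (x : 'I_n -> H) (k : nat) : 'I_n -> H :=
  iter k (mp_step (mp n.-1)) x.

End Busemann.

Arguments busemann_npc {R} H.

(* Main.v *)
Require Import Defs.
From mathcomp Require Import all_boot all_order all_algebra.
From mathcomp Require Import classical_sets reals topology.
From mathcomp Require Import finmap lra.
From mathcomp Require Import sequences metric_structure.

Import Order.TTheory GRing.Theory Num.Theory.
Import metricType_numDomainType.

Local Open Scope classical_set_scope.
Local Open Scope ring_scope.

(** Write d for the distance and M for a mean-point map on nets of at most m
points, m >= 2. One property of M is carried through the induction on m,
[balanced]: there is a weight w in (0, 1] such that whenever all points of a
net S lie within C of a point z, and s is one of them,

  d z (M S) <= (1 - w) * C + w * d z s.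

So every point of the net attracts its mean by a fixed amount, and in
particular balls are stable under M.

A balanced map makes the construction on m + 1 points converge
([iter_step_cvg]). Let D bound the mutual distances of the points u_h, and let
a, b be the means of the nets omitting u_i and u_j. As m + 1 >= 3, the two nets
share a point u_k. All points are within D of a, and u_k is within (1 - w) D
of a, since it attracts a and is at distance 0 from itself; then u_k attracts b,
so d a b <= (1 - w) D + w (1 - w) D = (1 - w^2) D ([step_contract]). The
diameter of the k-th tuple thus tends to 0 geometrically, while all later
points stay in the ball of that radius about any of its points, because balls
are stable. Every sequence is therefore Cauchy and they have the same limit.

The limit is again balanced, with weight w^2 ([mp_balanced]): a given u_j is
missing from only one of the nets of the first step, so it attracts all but one
of the new points, and every net of the second step contains one of these
([iter_step_pull]). The induction starts from the midpoint, for which the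
property with w = 1/2 is the convexity of the distance to a point
([midpoint_convex]).

The means a and b are compared through the shared point u_k and not through the
distance of u_i to u_j: mean points may collide during the construction, and the
mean of a net jumps when two of its points merge, so the mean cannot be expected
to be Lipschitz in the points of the net. *)

Section MeanPoint.
Set Implicit Arguments.
Unset Strict Implicit.

Context {R : realType} {H : completeMetricType R}.
Implicit Types (x y z p : H) (S : {fset H}) (f : {fset H} -> H) (w C D : R).

Local Notation d := (@mdist R H).

Lemma mdist_midpointl x y : busemann_npc H ->
  d (midpoint x y) y = d x y / 2.
Proof.
move=> [+ _] => /(_ x y) [A [Ags _]]; have [g [g0 gd giso] defA] := Ags.
have d0 : 0 <= d x y by exact: mdist_ge0.
have xyP : exists z, exists A, [/\ geodesic_segment x y A, A z,
    d x z = d x y / 2 & d z y = d x y / 2].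
  exists (g (d x y / 2)), A; split => //.
  - rewrite defA; exists (d x y / 2) => //=; rewrite in_itv /=; lra.
  - have := giso 0 (d x y / 2); rewrite g0 sub0r normrN ger0_norm; last lra.
    by apply; lra.
  - have := giso (d x y / 2) (d x y).
    rewrite gd distrC ger0_norm; last lra.
    by move=> -> //; lra.
by have [B [_ _ _ ->]] := getPex xyP.
Qed.

(** Go from z to the midpoint of x and z, at distance d x z / 2, and from there
to the midpoint of x and y, at most d y z / 2 away by the curvature
inequality. *)
Lemma midpoint_convex z x y : busemann_npc H ->
  d z (midpoint x y) <= (d z x + d z y) / 2.
Proof.
move=> npcH; have xz := mdist_midpointl x z npcH.
have := npcH.2 x y z; rewrite (metric_sym y z) => yz.
have := metric_triangle z (midpoint x z) (midpoint x y).
rewrite (metric_sym z (midpoint x z)) xz (metric_sym x z).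
rewrite (metric_sym (midpoint x z)); lra.
Qed.

(** A quantitative form of: the mean is a convex combination of the points of
the net with all weights at least w. Testing it on the functions [d z] only
makes it stable under limits. *)
Definition balanced w (m : nat) f : Prop :=
  0 < w <= 1 /\
  forall S z s C, (#|` S| <= m)%N -> s \in S ->
    (forall t, t \in S -> d z t <= C) -> d z (f S) <= (1 - w) * C + w * d z s.

Section Step.
Variables (w : R) (m : nat) (f : {fset H} -> H).
Hypotheses (m_ge2 : (2 <= m)%N) (fB : balanced w m f).

Implicit Types (i j : 'I_m.+1) (u : 'I_m.+1 -> H).

Lemma third_index i j : exists2 k : 'I_m.+1, k != i & k != j.
Proof.
have /card_gt0P[k] : (0 < #|predC (pred2 i j)|)%N.
  rewrite -(ltn_add2l #|pred2 i j|) addn0 cardC card2 card_ord ltnS.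
  by case: (i != j) => //; apply: ltnW.
by rewrite !inE negb_or => /andP[ki kj]; exists k.
Qed.

Lemma step_pull u z C i j : j != i -> (forall k, d z (u k) <= C) ->
  d z (mp_step f u i) <= (1 - w) * C + w * d z (u j).
Proof.
move=> ji uC; apply: fB.2.
- have sz : size [seq u k | k in predC1 i] = m.
    by rewrite size_map -cardE cardC1 card_ord.
  rewrite -[leqRHS]sz; apply: uniq_leq_size (fset_uniq _) _ => t /imfsetP[k ki ->].
  by apply: map_f; rewrite mem_enum.
- by apply/imfsetP; exists j.
- by move=> t /imfsetP[k _ ->].
Qed.

Lemma step_le u z C i : (forall k, d z (u k) <= C) -> d z (mp_step f u i) <= C.
Proof.
move=> uC; have [j ji _] := third_index i i.
apply: le_trans (step_pull ji uC) _.
have [/andP[w0 _] _] := fB; have := uC j; nra.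
Qed.

(** A point common to the two nets is close to both means, hence brings them
together. *)
Lemma step_contract u D i j : (forall k l, d (u k) (u l) <= D) ->
  d (mp_step f u i) (mp_step f u j) <= (1 - w ^+ 2) * D.
Proof.
move=> uD; have [k ki kj] := third_index i j.
have far l : d (mp_step f u i) (u l) <= D.
  by rewrite metric_sym; apply: step_le.
have near_k : d (mp_step f u i) (u k) <= (1 - w) * D.
  rewrite metric_sym; apply: le_trans (step_pull ki (uD k)) _.
  by rewrite mdistxx mulr0 addr0.
apply: le_trans (step_pull kj far) _.
have [/andP[w0 _] _] := fB; nra.
Qed.

Lemma iter_step_le u z C k i : (forall j, d z (u j) <= C) ->
  d z (iter k (mp_step f) u i) <= C.
Proof.
by move=> uC; elim: k i => [//|k IHk] i; rewrite iterS; apply: step_le.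
Qed.

Lemma iter_step_diam u D k i j : (forall k l, d (u k) (u l) <= D) ->
  d (iter k (mp_step f) u i) (iter k (mp_step f) u j) <= (1 - w ^+ 2) ^+ k * D.
Proof.
move=> uD; elim: k i j => [|k IHk] i j; first by rewrite expr0 mul1r.
by rewrite exprS -mulrA iterS; apply: step_contract.
Qed.

(** Balls are stable under a step, so the k-th tuple never leaves the ball about
one of its points whose radius is its diameter. *)
Lemma iter_step_near u D k l i j : (forall k l, d (u k) (u l) <= D) ->
  d (iter k (mp_step f) u i) (iter (l + k) (mp_step f) u j)
    <= (1 - w ^+ 2) ^+ k * D.
Proof.
by move=> uD; rewrite iterD; apply: iter_step_le => h; apply: iter_step_diam.
Qed.

Lemma iter_step_cvg u :
  exists p : H, forall i, iter k (mp_step f) u i @[k --> \oo] --> p.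
Proof.
pose D := \big[Order.max/0]_(h : 'I_m.+1 * 'I_m.+1) d (u h.1) (u h.2).
have uD k l : d (u k) (u l) <= D by exact: (le_bigmax _ _ (k, l)).
have r01 : `|1 - w ^+ 2| < 1.
  have [/andP[w0 w1] _] := fB; rewrite ger0_norm; nra.
have small e : 0 < e -> exists k, forall l i j,
    d (iter k (mp_step f) u i) (iter (l + k) (mp_step f) u j) < e.
  move=> e0.
  have Dr_cvg := iffLR (cvgrPdist_lt (V := R^o) _ _) (cvg_geometric D r01).
  have [k _ /(_ k (leqnn k))] := Dr_cvg _ e e0.
  rewrite /mdist /= subr0 => ke.
  exists k => l i j; apply: le_lt_trans (iter_step_near k l i j uD) _.
  by apply: le_lt_trans ke; rewrite mulrC; apply: ler_norm.
(* One sequence converges by completeness; the others stay close to it. *)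
have : cvg (iter k (mp_step f) u ord0 @[k --> \oo]).
  apply: cauchy_cvg; apply/cauchyP => e e0.
  have [k uk] := small e e0.
  exists (iter k (mp_step f) u ord0); exists k => // l /= kl.
  by rewrite ballEmdist /= -(subnK kl).
move=> /cvg_ex [p up]; exists p => i; apply/cvgrPdist_lt => e e0.
have e2 : 0 < e / 2 by lra.
have [k uk] := small (e / 2 / 2) ltac:(lra).
have [k0 _ pk0] := (iffLR (cvgrPdist_lt _ _)) up _ e2.
exists (maxn k0 k) => // l /=; rewrite geq_max => /andP[k0l kl].
have pl := pk0 l k0l; rewrite /= in pl.
have := metric_triangle p (iter l (mp_step f) u ord0) (iter l (mp_step f) u i).
have := metric_triangle (iter l (mp_step f) u ord0)
  (iter k (mp_step f) u ord0) (iter l (mp_step f) u i).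
have := uk (l - k)%N ord0 ord0; have := uk (l - k)%N ord0 i.
rewrite (subnK kl) [d _ (iter l (mp_step f) u ord0)]metric_sym; lra.
Qed.

(** Two steps are needed: in the first, the net with index j is the one that
omits u_j. *)
Lemma iter_step_pull u z C i j k : (2 <= k)%N -> (forall h, d z (u h) <= C) ->
  d z (iter k (mp_step f) u i) <= (1 - w ^+ 2) * C + w ^+ 2 * d z (u j).
Proof.
move=> /subnK <- uC; rewrite iterD.
apply: iter_step_le => h; rewrite [iter 2 _ _ _]/=.
have [l lh lj] := third_index h j.
have jl : j != l by rewrite eq_sym.
(* The index l is neither h, so the second net at h has the point of index l,
   nor j, so u_j has attracted that point. *)
have step1 := step_pull jl uC.
apply: le_trans (step_pull lh (fun h => step_le h uC)) _.
have [/andP[w0 _] _] := fB; nra.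
Qed.

End Step.

Lemma limit_le (v : nat -> H) p z C N :
  v k @[k --> \oo] --> p -> (forall k, (N <= k)%N -> d z (v k) <= C) -> d z p <= C.
Proof.
move=> vp vC; apply/ler_addgt0Pr => e e0.
have [k0 _ pk0] := (iffLR (cvgrPdist_lt _ _)) vp _ e0.
have := pk0 (maxn k0 N) (leq_maxl _ _); have := vC _ (leq_maxr k0 N).
have := metric_triangle z (v (maxn k0 N)) p.
rewrite (metric_sym p) /=; lra.
Qed.

(** The pair {x, y} whose midpoint defines the mean of S may come in either
order; the convexity bound is symmetric, so both serve. *)
Lemma mp2_balanced : busemann_npc H -> balanced (1 / 2) 2 (@mp R H 2).
Proof.
move=> npcH; split=> [|S z s C cardS sS SC]; first by lra.
have : exists p x y, S = [fset x; y]%fset /\ p = midpoint x y.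
  have [->|[y ->]] : S = [fset s]%fset \/ exists y, S = [fset s; y]%fset.
  - have defS := fsetD1K sS; move: cardS; rewrite (cardfsD1 s) sS add1n ltnS.
    rewrite leq_eqVlt ltnS leqn0 cardfs_eq0 => /orP[/cardfs1P[y Sy]|/eqP S0].
      by right; exists y; rewrite -defS Sy.
    by left; rewrite -defS S0 fsetU0.
  - by exists (midpoint s s), s, s; rewrite fsetUid.
  - by exists (midpoint s y), s, y.
move=> /getPex [x [y [defS]]]; rewrite -/(mp 2 S) => ->.
have := midpoint_convex z x y npcH.
have := SC x; have := SC y; rewrite defS !in_fset2 !eqxx orbT => /(_ isT) + /(_ isT).
move: sS; rewrite defS in_fset2 => /orP[]/eqP->; lra.
Qed.

(** Nets with at most m points keep their mean at stage m + 1, and the weight w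
may be lowered to w^2; for the others, the mean is a limit of points that
satisfy the bound of [iter_step_pull]. *)
Lemma mp_balanced m : busemann_npc H -> (2 <= m)%N ->
  exists w, balanced w m (@mp R H m).
Proof.
move=> npcH; elim: m => [//|m IHm]; rewrite leq_eqVlt => /predU1P[<-|].
  by exists (1 / 2); apply: mp2_balanced.
rewrite ltnS => m_ge2; have [w fB] := IHm m_ge2.
exists (w ^+ 2); have [/andP[w0 w1] fE] := fB.
split=> [|S z s C cardS sS SC]; first by nra.
have mpE : mp m.+1 S = if (#|` S| <= m)%N then mp m S else
    get [set p | exists x : 'I_m.+1 -> H,
      [/\ injective x, S = [fset x i | i : 'I_m.+1]%fset &
          forall i, iter k (mp_step (mp m)) x i @[k --> \oo] --> p]].
  by case: (m) m_ge2 => [|[]].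
rewrite mpE; case: leqP => Sm.
  apply: le_trans (fE S z s C Sm sS SC) _.
  have ww : 0 <= w * (1 - w) by nra.
  have := SC s sS; nra.
have {cardS Sm} cardS : #|` S| = m.+1 by apply/eqP; rewrite eqn_leq cardS.
(* A limit exists, by convergence from an enumeration of S; the chosen one may
   come from another enumeration, which is why only its defining property is
   used afterwards. *)
have : exists p, exists x : 'I_m.+1 -> H,
      [/\ injective x, S = [fset x i | i : 'I_m.+1]%fset &
          forall i, iter k (mp_step (mp m)) x i @[k --> \oo] --> p].
  pose x (i : 'I_m.+1) := nth s (enum_fset S) i.
  have [p xp] := iter_step_cvg m_ge2 fB x.
  exists p, x; split=> //.
    by move=> i j /eqP; rewrite nth_uniq ?fset_uniq ?cardS // => /eqP/val_inj.
  apply/fsetP => t; apply/idP/imfsetP => [tS|[i _ ->]].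
    have tm : (index t (enum_fset S) < m.+1)%N by rewrite -cardS index_mem.
    by exists (Ordinal tm); rewrite //= /x nth_index.
  by apply: mem_nth; rewrite cardS.
move=> /getPex; set p := get _ => -[x [_ defS xp]].
move: sS; rewrite defS => /imfsetP[i _ ->].
have xC h : d z (x h) <= C by apply: SC; rewrite defS; apply/imfsetP; exists h.
apply: (limit_le (N := 2) (xp i)) => k k2.
by apply: iter_step_pull.
Qed.

End MeanPoint.

Theorem mainTheorem1 (R : realType) (H : completeMetricType R)
    (busemannH : busemann_npc H) (n : nat) (n_ge3 : (3 <= n)%N)
    (x : 'I_n -> H) (x_inj : injective x) :
  exists p : H, forall i : 'I_n, mp_seq x k i @[k --> \oo] --> p.
Proof.
case: n n_ge3 x x_inj => [//|m] m_ge2 x _.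
have [w mpB] := mp_balanced busemannH m_ge2.
exact: iter_step_cvg m_ge2 mpB x.
Qed.
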